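(* Let $n\ge1$ and let $F$ be a facet of ${\cal H}(B(n))$ such that $$F\setminus E(B(n))=\{(p,q)\mid\{p,q\}\in T\}\cup O,$$ where $T$ is a spanning tree of $K_n$ and $O$ is an acyclic orientation of $K_n\setminus T$. Then the number of strict linear orders $L$ on $\{1,\dots,n\}$ such that $F=\Phi(L,T,\mathcal O_L)$, where $\mathcal O_L$ is the orientation of $T$ opposite to $L$, equals the number of linear extensions of the partial order on $\{1,\dots,n\}$ determined by $O$.
   Context: For $n\ge1$, $B(n)$ denotes the aperiodic Brandt semigroup: the set $(\{1,\dots,n\}\times\{1,\dots,n\})\cup\{0\}$, where $0$ is a zero element and $(i,j)(k,l)=(i,l)$ if $j=k$ and $(i,j)(k,l)=0$ otherwise. Its set of idempotents is $E(B(n))=\{0\}\cup\{(i,i)\mid1\le i\le n\}$. For $Y\subseteq B(n)$, $Y^+$ denotes the subsemigroup generated by $Y$ ($\emptyset^+=\emptyset$). The subsemigroup complex ${\cal H}(B(n))$ has vertex set $B(n)$, and a subset $X$ is a face iff it admits an enumeration $x_1,\dots,x_k$ with $\emptyset\subset\{x_1\}^+\subset\cdots\subset\{x_1,\dots,x_k\}^+$ (all inclusions strict); a facet is a maximal face. $K_n$ is the complete undirected graph on $\{1,\dots,n\}$; $K_n\setminus T$ is $K_n$ with the edges of $T$ removed. An orientation of an undirected graph $(V,E)$ is a relation $O\subseteq V\times V$ such that $(p,q)\mapsto\{p,q\}$ is a bijection $O\to E$; it is acyclic if it has no directed cycle. The partial order determined by an acyclic orientation $O$ is $v\le_O w$ iff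 there is a directed path (possibly empty) from $v$ to $w$ using edges of $O$; a linear extension is a strict linear order $<$ with $v<w$ whenever $v\le_O w$ and $v\ne w$. Given a strict linear order $<_L$ and spanning tree $T$, the orientation of $T$ opposite to $L$ is $\mathcal O_L=\{(p,q)\mid\{p,q\}\in T,\ q<_L p\}$, and $\Phi(L,T,\mathcal O_L)=\{0\}\cup\{(i,j)\mid i<_L j\}\cup E(B(n))\cup\mathcal O_L$. *)

(* Defs.v *)
From HB Require Import structures.
From mathcomp Require Export all_boot.

Set Implicit Arguments.
Unset Strict Implicit.
Unset Printing Implicit Defensive.

Local Open Scope group_scope.

#[short(type="finSemigroupType")]
HB.structure Definition FinSemigroup := {G of Semigroup G & Finite G}.

Section SubsemigroupComplex.

Variable G : finSemigroupType.
Implicit Types S X Y : {set G}.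

Definition mul_closedb S : bool := [forall u in S, forall v in S, u * v \in S].

Lemma mul_closedP S : reflect (mulg_closed S) (mul_closedb S).
Proof.
apply: (iffP forall_inP) => [h u v uS vS | h u uS].
  by have /forall_inP := h u uS; apply.
by apply/forall_inP => v; apply: h.
Qed.

(* The empty set is closed, so [subsemigroup_gen set0 = set0]. *)
Definition subsemigroup_gen Y : {set G} :=
  \bigcap_(S : {set G} | (Y \subset S) && mul_closedb S) S.

Lemma sub_subsemigroup_gen Y : Y \subset subsemigroup_gen Y.
Proof. by apply/bigcapsP => S /andP[]. Qed.

Lemma subsemigroup_gen_closed Y : mulg_closed (subsemigroup_gen Y).
Proof.
move=> u v /bigcapP uY /bigcapP vY; apply/bigcapP => S hS.
case/andP: (hS) => _ /mul_closedP; apply; [exact: uY | exact: vY].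
Qed.

Lemma subsemigroup_gen_min Y S :
  Y \subset S -> mulg_closed S -> subsemigroup_gen Y \subset S.
Proof.
by move=> YS cS; apply: bigcap_inf; rewrite YS /=; apply/mul_closedP.
Qed.

Lemma subsemigroup_gen0 : subsemigroup_gen set0 = set0.
Proof.
apply/eqP; rewrite -subset0; apply: subsemigroup_gen_min => // u v.
by rewrite inE.
Qed.

(* With [i = 0] this gives the first inclusion, from the empty set.
   Repetitions in [s] are excluded by strictness. *)
Definition generating_chain (s : seq G) : Prop :=
  forall i, i < size s ->
    subsemigroup_gen [set x in take i s]
      \proper subsemigroup_gen [set x in take i.+1 s].

Definition face X : Prop :=
  exists s : seq G, X = [set x in s] /\ generating_chain s.

Definition facet X : Prop :=
  face X /\ forall X', face X' -> X \subset X' -> X' = X.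

Definition idempotents : {set G} := [set x | x * x == x].

End SubsemigroupComplex.

(* [None] is the zero and [Some (i, j)] the pair [(i, j)]; the indices
   [1, ..., n] become [0, ..., n - 1]. *)
Definition brandt (n : nat) : Type := option ('I_n * 'I_n).

HB.instance Definition _ (n : nat) := Finite.on (brandt n).

Definition brandt0 (n : nat) : brandt n := None.
Definition brandt_elt (n : nat) (e : 'I_n * 'I_n) : brandt n := Some e.

Definition brandt_mul (n : nat) (x y : brandt n) : brandt n :=
  match x, y with
  | Some (i, j), Some (k, l) => if j == k then brandt_elt (i, l) else brandt0 n
  | _, _ => brandt0 n
  end.

Lemma brandt_mulA (n : nat) : associative (@brandt_mul n).
Proof.
case=> [[i j]|] [[k l]|] [[p q]|] //=; last by case: eqP.
by case: (l =P p) => lp /=; case: (j =P k) => jk //=; case: eqP.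
Qed.

HB.instance Definition _ (n : nat) :=
  isSemigroup.Build (brandt n) (@brandt_mulA n).

Definition brandt_elts (n : nat) (R : {set 'I_n * 'I_n}) : {set brandt n} :=
  [set brandt_elt e | e in R].

Lemma idempotents_brandt (n : nat) :
  idempotents (brandt n) = brandt0 n |: [set brandt_elt (i, i) | i : 'I_n].
Proof.
apply/setP; case=> [[i j]|]; rewrite !inE //=.
apply/eqP/imsetP => [|[k _ [-> ->]]]; last by rewrite /mul /= eqxx.
by rewrite /mul /=; case: eqP => // -> _; exists i.
Qed.

(* An undirected simple graph on [V] is given by its set of edges, each a
   two-element set of vertices; directed edges and order relations on [V] are
   sets of ordered pairs. *)
Section Graphs.

Variable V : finType.
Implicit Types (E T : {set {set V}}) (D L : {set V * V}).

Definition complete_edges : {set {set V}} := [set e : {set V} | #|e| == 2].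

Definition uedge (e : V * V) : {set V} := [set e.1; e.2].

Definition adj E : rel V := fun p q => uedge (p, q) \in E.

Definition connected E : Prop := forall p q, connect (adj E) p q.

(* Cycles of length at most two are degenerate in an undirected graph. *)
Definition acyclic E : Prop :=
  forall s : seq V, uniq s -> 2 < size s -> ~~ cycle (adj E) s.

Definition spanning_tree E T : Prop :=
  [/\ T \subset E, connected T & acyclic T].

Definition orientation E D : Prop :=
  {in D &, injective uedge} /\ uedge @: D = E.

Definition arc_rel D : rel V := fun p q => (p, q) \in D.

Definition acyclic_orientation E D : Prop :=
  orientation E D /\ forall s : seq V, ucycle (arc_rel D) s -> s = [::].

Definition symmetric_arcs T : {set V * V} := [set e | uedge e \in T].

Definition orientation_le D : rel V := connect (arc_rel D).

Definition strict_linear_order L : bool :=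
  [&& [forall v, (v, v) \notin L],
      [forall u, forall v, forall w,
         ((u, v) \in L) && ((v, w) \in L) ==> ((u, w) \in L)]
    & [forall v, forall w,
         (v != w) ==> ((v, w) \in L) || ((w, v) \in L)]].

Definition linear_extension D L : bool :=
  strict_linear_order L &&
  [forall v, forall w, orientation_le D v w && (v != w) ==> ((v, w) \in L)].

Definition opposite_orientation L T : {set V * V} :=
  [set e | (uedge e \in T) && ((e.2, e.1) \in L)].

End Graphs.

(* The spanning tree enters only through its orientation [D]. *)
Definition Phi (n : nat) (L D : {set 'I_n * 'I_n}) : {set brandt n} :=
  [set brandt0 n] :|: brandt_elts L :|: idempotents (brandt n)
    :|: brandt_elts D.

(* Main.v *)
Require Import Defs.

Set Implicit Arguments.
Unset Strict Implicit.
Unset Printing Implicit Defensive.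

(** Adjoining an idempotent of [B(n)] to a subsemigroup containing [0] creates
    no new product, so enumerating [E(B(n))] first and then the non-idempotents
    of a face again gives a strict chain; hence a facet contains [E(B(n))].
    Therefore [F = Phi(L, T, O_L)] only constrains the arcs outside [T], where
    it says that [L] contains [O], i.e. that [L] extends the order of [O]. *)

(** * Faces in an arbitrary finite semigroup *)

Section Faces.

Local Open Scope group_scope.

Variable G : finSemigroupType.
Implicit Types (E X Y : {set G}) (s : seq G).

Lemma subsemigroup_genS X Y :
  X \subset Y -> subsemigroup_gen X \subset subsemigroup_gen Y.
Proof.
move=> XY; apply: subsemigroup_gen_min; last exact: subsemigroup_gen_closed.
exact: subset_trans XY (sub_subsemigroup_gen Y).
Qed.

Lemma subsemigroup_gen_properU1 x Y :
  (subsemigroup_gen Y \proper subsemigroup_gen (x |: Y))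
    = (x \notin subsemigroup_gen Y).
Proof.
rewrite properE subsemigroup_genS ?subsetUr //=; congr negb.
apply/idP/idP => [/subsetP|xY].
  by apply; apply: (subsetP (sub_subsemigroup_gen _)); rewrite setU11.
apply: subsemigroup_gen_min; last exact: subsemigroup_gen_closed.
by rewrite subUset sub1set xY sub_subsemigroup_gen.
Qed.

Lemma set_rcons s x : [set y in rcons s x] = x |: [set y in s].
Proof. by apply/setP => y; rewrite !inE mem_rcons inE. Qed.

(** Only the last inclusion of the chain involves [x]. This form supports induction on an
    enumeration from its end. *)
Lemma generating_chain_rcons s x :
  generating_chain (rcons s x) <->
  generating_chain s /\ x \notin subsemigroup_gen [set y in s].
Proof.
rewrite -subsemigroup_gen_properU1 -set_rcons.
have take_s i : i <= size s -> take i (rcons s x) = take i s.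
  by move=> le_is; rewrite -cats1 takel_cat.
have take_sx : take (size s).+1 (rcons s x) = rcons s x.
  by rewrite -(size_rcons s x) take_size.
split=> [chs|[chs chx] i].
  split=> [i lt_is|].
    have := chs i; rewrite size_rcons ltnS => /(_ (ltnW lt_is)).
    by rewrite !take_s // ltnW.
  by have := chs (size s); rewrite size_rcons take_sx take_s // take_size; apply.
rewrite size_rcons ltnS leq_eqVlt => /predU1P[->|lt_is].
  by rewrite take_sx take_s // take_size.
by rewrite !take_s ?chs // ltnW.
Qed.

Lemma face0 : face (set0 : {set G}).
Proof. by exists [::]; split=> //; apply/setP => x; rewrite !inE. Qed.

Lemma face_setU1 x X : face X -> x \notin subsemigroup_gen X -> face (x |: X).
Proof.
move=> [s [-> chs]] xX; exists (rcons s x); rewrite set_rcons; split=> //.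
exact/generating_chain_rcons.
Qed.

(** List [E] first, then the members of [X] outside [E] in their given order. As [E] together with
    the subsemigroup generated by [Y] is closed, it contains everything generated by [E :|: Y]; so
    an [x] outside [E] that is new over [Y] is still new over [E :|: Y]. *)
Lemma face_setU E X :
  (forall Y, mulg_closed Y -> mulg_closed (E :|: Y)) ->
  face E -> face X -> face (E :|: X).
Proof.
move=> closedEU faceE [s [-> {X}]].
elim/last_ind: s => [_|s x IHs /generating_chain_rcons[chs xs]].
  suff -> : E :|: [set x in [::]] = E by [].
  by apply/setP => x; rewrite !inE orbF.
rewrite set_rcons setUCA; have [xE|xE] := boolP (x \in E).
  by rewrite (setUidPr _) ?sub1set ?inE ?xE //; apply: IHs.
apply: face_setU1; first exact: IHs.
apply: contra xs => xEs.
suff: x \in E :|: subsemigroup_gen [set y in s] by rewrite inE (negPf xE).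
apply: subsetP xEs; apply: subsemigroup_gen_min.
  exact: setUS (sub_subsemigroup_gen _).
by apply: closedEU; apply: subsemigroup_gen_closed.
Qed.

End Faces.

(** * Idempotents in faces of the Brandt semigroup *)

Section BrandtFaces.

Local Open Scope group_scope.

Variable n : nat.
Implicit Types (x y e f : brandt n) (X Y : {set brandt n}).

Lemma brandt_idempotentP e :
  reflect (e = brandt0 n \/ exists i, e = brandt_elt (i, i))
          (e \in idempotents (brandt n)).
Proof.
rewrite idempotents_brandt !inE.
apply: (iffP orP) => [[/eqP ->|/imsetP[i _ ->]]|[->|[i ->]]].
- by left.
- by right; exists i.
- by left.
- by right; apply: imset_f.
Qed.

Lemma brandt_mul_idempotentl e x :
  e \in idempotents (brandt n) -> e * x = brandt0 n \/ e * x = x.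
Proof.
case/brandt_idempotentP=> [->|[i ->]]; first by left.
case: x => [[k l]|]; last by left.
by rewrite /mul /=; case: eqP => [->|_]; [right|left].
Qed.

Lemma brandt_mul_idempotentr x e :
  e \in idempotents (brandt n) -> x * e = brandt0 n \/ x * e = x.
Proof.
case/brandt_idempotentP=> [->|[i ->]]; first by left; case: x => [[]|].
case: x => [[k l]|]; last by left.
by rewrite /mul /=; case: eqP => [->|_]; [right|left].
Qed.

(** A product with a factor in [X] is either [0], which lies in [X], or the other factor. *)
Lemma brandt_idempotents_setU_closed X Y :
  X \subset idempotents (brandt n) -> brandt0 n \in X ->
  mulg_closed Y -> mulg_closed (X :|: Y).
Proof.
move=> /subsetP idX X0 closedY x y; rewrite !inE => xXY yXY.
have [/idX ex|xX] := boolP (x \in X).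
  by have [->|->] := brandt_mul_idempotentl y ex; rewrite ?X0.
have [/idX ey|yX] := boolP (y \in X).
  by have [->|->] := brandt_mul_idempotentr x ey; rewrite ?X0.
move: xXY yXY; rewrite (negPf xX) (negPf yX) /= => xY yY.
by rewrite [_ \in Y]closedY ?orbT.
Qed.

(** A set of idempotents containing [0] is closed, hence generates only itself, so each further
    idempotent strictly enlarges the chain. The induction is on a bound for [#|X|]. *)
Lemma brandt_idempotents_sub_face X :
  X \subset idempotents (brandt n) -> face (brandt0 n |: X).
Proof.
move: {2}#|X| (leqnn #|X|) => m; elim: m X => [|m IHm] X.
  rewrite leqn0 cards_eq0 => /eqP-> _; apply: face_setU1; first exact: face0.
  by rewrite subsemigroup_gen0 inE.
move=> leXm idX.
have [X0|[x xX]] := set_0Vmem X; first by apply: IHm => //; rewrite X0 cards0.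
have idX' : X :\ x \subset idempotents (brandt n).
  exact: subset_trans (subD1set _ _) idX.
have faceX' : face (brandt0 n |: X :\ x).
  by apply: IHm => //; move: leXm; rewrite (cardsD1 x) xX.
rewrite -(setD1K xX) setUCA.
have [x0|x0] := eqVneq x (brandt0 n).
  by rewrite (setUidPr _) // sub1set x0 setU11.
apply: face_setU1 => //.
apply: contra (_ : x \notin brandt0 n |: X :\ x) => [xgen|]; last first.
  by rewrite !inE eqxx (negPf x0).
apply: subsetP xgen; apply: subsemigroup_gen_min => //.
(* Closedness of the set itself is the case [Y = set0]. *)
rewrite -[brandt0 n |: _]setU0; apply: brandt_idempotents_setU_closed.
- by rewrite subUset sub1set idX' andbT; apply/brandt_idempotentP; left.
- exact: setU11.
- by move=> u v; rewrite inE.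
Qed.

Lemma facet_idempotents_sub X : facet X -> idempotents (brandt n) \subset X.
Proof.
move=> [faceX maxX]; have E0 : brandt0 n \in idempotents (brandt n).
  by apply/brandt_idempotentP; left.
have faceE : face (idempotents (brandt n)).
  have <- : brandt0 n |: idempotents (brandt n) = idempotents (brandt n).
    by apply/setUidPr; rewrite sub1set.
  exact: brandt_idempotents_sub_face.
rewrite -(maxX (idempotents (brandt n) :|: X)) ?subsetUl ?subsetUr //.
apply: face_setU => // Y; exact: brandt_idempotents_setU_closed.
Qed.

End BrandtFaces.

(** * Linear orders and orientations *)

Section Extensions.

Variable V : finType.
Implicit Types (E T : {set {set V}}) (D L : {set V * V}).

Lemma strict_linear_orderP L :
  reflect [/\ forall v, (v, v) \notin L,
               forall u v w, (u, v) \in L -> (v, w) \in L -> (u, w) \in L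
             & forall v w, v != w -> (v, w) \in L \/ (w, v) \in L]
          (strict_linear_order L).
Proof.
apply: (iffP and3P) => [[irr tr tot]|[irr tr tot]]; split.
- exact/forallP.
- move=> u v w uv vw; move/forallP/(_ u)/forallP/(_ v)/forallP/(_ w): tr.
  by rewrite uv vw.
- move=> v w vw; move/forallP/(_ v)/forallP/(_ w): tot.
  by rewrite vw => /orP.
- exact/forallP.
- do 3![apply/forallP => ?]; apply/implyP => /andP[]; exact: tr.
- do 2![apply/forallP => ?]; apply/implyP => /tot/orP; exact.
Qed.

Lemma uedge_complete (p q : V) : (uedge (p, q) \in complete_edges V) = (p != q).
Proof. by rewrite inE cards2; case: (p == q). Qed.

Lemma uedge_eq (p q : V) e : uedge e = uedge (p, q) -> e = (p, q) \/ e = (q, p).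
Proof.
case: e => a b /setP eqE.
move: (eqE a) (eqE b) (eqE p) (eqE q); rewrite !inE /= !eqxx ?orbT.
(* The cases are [a] in [{p, q}] times [b] in [{p, q}]; if [a = b], the memberships of [p] and [q]
   force [p = q]. *)
move=> /esym/orP[] /eqP-> /esym/orP[] /eqP->; rewrite ?orbb.
- by move=> _ /eqP->; left.
- by left.
- by right.
- by move=> /eqP->; left.
Qed.

(** An arc of [D] is a path of length one whose ends differ, its edge having two elements;
    conversely, transitivity of [L] carries [D \subset L] along paths. *)
Lemma linear_extension_sub E D L :
  E \subset complete_edges V -> @uedge V @: D = E ->
  linear_extension D L = strict_linear_order L && (D \subset L).
Proof.
move=> sE DE; rewrite /linear_extension.
case: strict_linear_orderP => //= -[irr tr tot]; apply/idP/subsetP => [ext|DL].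
  move=> [p q] pqD; move/forallP/(_ p)/forallP/(_ q)/implyP: ext; apply.
  rewrite /orientation_le connect1 //= -uedge_complete.
  by apply: (subsetP sE); rewrite -DE imset_f.
apply/forallP => p; apply/forallP => q; apply/implyP => /andP[/connectP[s ps ->]].
elim: s p ps => [|r s IHs] p /=; first by rewrite eqxx.
case/andP=> /DL pr /IHs rs _; have [<-//|r_neq] := eqVneq r (last r s).
exact: tr pr (rs r_neq).
Qed.

(** Over an edge of [T] both sides contain both arcs, by totality of [L]. Off [T] the equation reads
    [L = D], and since [D] orients every such edge, asymmetry of [L] upgrades [D \subset L] to
    equality there. *)
Lemma opposite_orientation_eq T D L :
  T \subset complete_edges V -> @uedge V @: D = complete_edges V :\: T ->
  strict_linear_order L ->
  (L :|: opposite_orientation L T == symmetric_arcs T :|: D) = (D \subset L).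
Proof.
move=> sT DE /strict_linear_orderP[irr tr tot].
have asym p q : (p, q) \in L -> (q, p) \notin L.
  by move=> pq; apply: contra (irr p); apply: tr pq.
have D_T e : e \in D -> (uedge e \in T) = false.
  by move=> eD; have := imset_f (@uedge V) eD; rewrite DE inE => /andP[/negPf].
apply/eqP/subsetP => [/setP eqF e eD|DL].
  by have := eqF e; rewrite !inE eD (D_T e eD) orbT orbF.
apply/setP => -[p q]; rewrite !inE /=.
have [pqT|pqT] /= := boolP (uedge (p, q) \in T).
  by apply/orP/tot; rewrite -uedge_complete (subsetP sT).
rewrite orbF; apply/idP/idP => [pqL|]; last exact: DL.
(* [D] contains [(p, q)] or [(q, p)]; the latter would put [(q, p)] in [L] as well. *)
have : uedge (p, q) \in @uedge V @: D.
  rewrite DE inE pqT uedge_complete; apply: contraTneq pqL => ->; exact: irr.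
case/imsetP=> e eD /esym/uedge_eq[] eE; rewrite -?eE //.
by have := DL e eD; rewrite eE (negPf (asym _ _ pqL)).
Qed.

End Extensions.

(** * Comparing a facet with [Phi] *)

Section BrandtElts.

Variable n : nat.
Implicit Types R D L : {set 'I_n * 'I_n}.

Lemma brandt_eltsU R D :
  brandt_elts (R :|: D) = brandt_elts R :|: brandt_elts D.
Proof. exact: imsetU. Qed.

Lemma brandt_elts_inj : injective (@brandt_elts n).
Proof. by apply: imset_inj => e f []. Qed.

Lemma brandt_elts_idempotents_disjoint R :
  (forall i, (i, i) \notin R) ->
  brandt_elts R :\: idempotents (brandt n) = brandt_elts R.
Proof.
move=> irr; apply/setDidPl; rewrite disjoint_subset; apply/subsetP => x.
case/imsetP=> e eR ->; rewrite inE; apply/negP.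
case/brandt_idempotentP=> [//|[i [eE]]].
by have := irr i; rewrite -eE eR.
Qed.

(** Both [F] and [Phi L D] contain all idempotents, so they agree as soon as their non-idempotent
    parts do; without diagonal pairs, that part of [Phi L D] is given by [L :|: D]. *)
Lemma facet_eq_Phi F R L D :
  facet F -> F :\: idempotents (brandt n) = brandt_elts R ->
  (forall i, (i, i) \notin L :|: D) ->
  (F == Phi L D) = (L :|: D == R).
Proof.
move=> /facet_idempotents_sub sEF FR irr; rewrite -(inj_eq brandt_elts_inj) -FR.
have PhiE : Phi L D = idempotents (brandt n) :|: brandt_elts (L :|: D).
  rewrite /Phi brandt_eltsU (setUAC _ (brandt_elts L)) -(setUA _ (brandt_elts L));
    congr (_ :|: _).
  by apply/setUidPr; rewrite sub1set; apply/brandt_idempotentP; left.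
have disj := brandt_elts_idempotents_disjoint irr.
rewrite PhiE; apply/eqP/eqP => [->|->]; first by rewrite setDUl setDv set0U disj.
by rewrite -{1}(setID F (idempotents (brandt n))) (setIidPr sEF).
Qed.

End BrandtElts.

Theorem theorem5p23 (n : nat) (F : {set brandt n})
    (T : {set {set 'I_n}}) (D : {set 'I_n * 'I_n}) :
  0 < n ->
  facet F ->
  spanning_tree (complete_edges 'I_n) T ->
  acyclic_orientation (complete_edges 'I_n :\: T) D ->
  F :\: idempotents (brandt n)
    = brandt_elts (symmetric_arcs T) :|: brandt_elts D ->
  #|[set L : {set 'I_n * 'I_n} |
      strict_linear_order L && (F == Phi L (opposite_orientation L T))]|
    = #|[set L : {set 'I_n * 'I_n} | linear_extension D L]|.
Proof.
move=> _ facetF [sT _ _] [[_ DE] _]; rewrite -brandt_eltsU => FE.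
(* The two counted sets of orders are equal: for each strict linear order both conditions amount to
   [D \subset L]. *)
apply: eq_card => L; rewrite !inE (linear_extension_sub _ (subsetDl _ T) DE).
have [ordL|//] := boolP (strict_linear_order L).
have [irr _ _] := strict_linear_orderP _ ordL.
rewrite /= (facet_eq_Phi facetF FE) ?(opposite_orientation_eq sT DE ordL) // => i.
(* A diagonal pair is its own reversal, so irreflexivity of [L] excludes it from the opposite
   orientation too. *)
by rewrite !inE /= andbC (negPf (irr i)).
Qed.
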